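(* Let $F\in\mathbb{R}^{m\times m}$ and $G\in\mathbb{R}^{n\times n}$ be real symmetric matrices. Then $$\mathrm{EC}(F,G)=C_{\mathrm{sig}}\,A_{\mathrm{sig}}(F,G).$$
   Context: Here $m,n\ge 1$. Let $\alpha_1\le\dots\le\alpha_m$ and $\beta_1\le\dots\le\beta_n$ be the eigenvalues, with multiplicity, of $F$ and $G$. Generic eigenvalue configuration: a pair of real symmetric matrices is generic if they share no eigenvalue. For a generic pair $(F,G)$, put $A_t=\{x\in\mathbb{R}:\alpha_t<x<\alpha_{t+1}\}$ for $t=1,\dots,m$, with $\alpha_{m+1}=\infty$, and define $\mathrm{GEC}(F,G)=(c_1,\dots,c_m)$ with $c_t=\#\{i:\beta_i\in A_t\}$. Eigenvalue configuration of arbitrary real symmetric $F,G$: $$\mathrm{EC}(F,G)=\frac1{2^m}\sum_{d\in\{-\varepsilon,\varepsilon\}^m}\mathrm{GEC}(F_d,G)\in\mathbb{Q}^m,$$ regarded as a column vector, where $\varepsilon=\frac12\min_{i,j}\delta_{ij}$ with $\delta_{ij}=1$ if $\alpha_i=\beta_j$ and $\delta_{ij}=|\alpha_i-\beta_j|$ otherwise, and $F_d$ is any real symmetric $m\times m$ matrix with eigenvalues $\alpha_i+d_i$, $i=1,\dots,m$ (so each pair $(F_d,G)$ is generic, and $\mathrm{GEC}(F_d,G)$ depends only on these eigenvalues, re-sorted in nondecreasing order). Combinatorial part: $C_{\mathrm{sig}}=V H^{-1}\in\mathbb{Q}^{m\times 2^m}$, where - $H$ is the (invertible) $2^m\times 2^m$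 matrix with rows indexed by $e\in\{0,1\}^m$, columns indexed by $s\in\{-,+\}^m$ (both lexicographically, with $0<1$ and $-<+$), and entries $H_{e,s}=s_1^{e_1}\cdots s_m^{e_m}$, reading $-$ as $-1$ and $+$ as $1$; - $V$ is the $m\times 2^m$ matrix with rows indexed by $t\in\{1,\dots,m\}$, columns indexed lexicographically by $s\in\{-,+\}^m$, and $V_{t,s}=1$ if $v(s,+)=m-t$ and $0$ otherwise, where $v(s,+)$ is the number of sign changes between consecutive elements (ignoring zeros) of the sequence obtained by appending $+$ to $s$. Algebraic part: $A_{\mathrm{sig}}(F,G)$ is the column vector indexed lexicographically by $e=(e_0,\dots,e_{m-1})\in\{0,1\}^m$ with entries $\sigma(f_e(G))$, where $\sigma$ is the signature of a real symmetric matrix (number of positive eigenvalues minus number of negative eigenvalues, with multiplicity), $f(x)=\det(xI_m-F)$, $f^{(k)}$ is the $k$-th derivative of $f$, and $f_e=(f^{(0)})^{e_0}\cdots(f^{(m-1)})^{e_{m-1}}$. *)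

(* Defs.v *)
From HB Require Import structures.
From mathcomp Require Import all_boot all_order all_algebra.
From mathcomp Require Import polyrcf.
From mathcomp Require Import reals.

Set Implicit Arguments.
Unset Strict Implicit.
Unset Printing Implicit Defensive.

Import Order.TTheory GRing.Theory Num.Theory.
Local Open Scope ring_scope.

(* Real roots of the characteristic polynomial, in nondecreasing order, each
   repeated according to its multiplicity.  For a symmetric matrix these are
   all the roots, so the list has length n. *)
Definition eigenvalues (R : rcfType) (n : nat) (A : 'M[R]_n) : seq R :=
  flatten [seq nseq (mup x (char_poly A)) x | x <- rootsR (char_poly A)].

(* alpha A i is the (i+1)-st smallest eigenvalue. *)
Definition alpha (R : rcfType) (n : nat) (A : 'M[R]_n) (i : nat) : R :=
  nth 0 (eigenvalues A) i.

Definition signature (R : rcfType) (n : nat) (A : 'M[R]_n) : int :=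
  (count (fun x => 0 < x) (eigenvalues A))%:Z
  - (count (fun x => x < 0) (eigenvalues A))%:Z.

(* Indices are 0-based: t : 'I_m stands for t+1.  The upper bound is dropped
   for the last t, where it is infinite. *)
Definition in_A (R : rcfType) (m : nat) (F : 'M[R]_m) (t : 'I_m) (x : R) :
    bool :=
  (alpha F t < x) && ((t.+1 < m)%N ==> (x < alpha F t.+1)).

(* Only meaningful when F and G share no eigenvalue; the definition is total. *)
Definition GEC (R : rcfType) (m n : nat) (F : 'M[R]_m) (G : 'M[R]_n) :
    'cV[rat]_m :=
  \col_(t < m) (count (in_A F t) (eigenvalues G))%:R.

Definition delta (R : rcfType) (a b : R) : R :=
  if a == b then 1 else `|a - b|.

(* The head of the list is only used to give the minimum a neutral value. *)
Definition epsilon (R : rcfType) (m n : nat) (F : 'M[R]_m) (G : 'M[R]_n) : R :=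
  let ds := [seq delta a b | a <- eigenvalues F, b <- eigenvalues G] in
  2^-1 * \big[Num.min/head 0 ds]_(d <- ds) d.

(* A representative of the symmetric matrices with eigenvalues alpha_i + d_i;
   by GEC_eigenvalues below the choice is immaterial. *)
Definition perturbed (R : rcfType) (m : nat) (F : 'M[R]_m) (d : 'I_m -> R) :
    'M[R]_m :=
  diag_mx (\row_(i < m) (alpha F i + d i)).

(* s ranges over the sign vectors, true standing for +epsilon. *)
Definition EC (R : rcfType) (m n : nat) (F : 'M[R]_m) (G : 'M[R]_n) :
    'cV[rat]_m :=
  (2%:R ^+ m)^-1 *:
  \sum_(s : {ffun 'I_m -> bool})
     GEC (perturbed F (fun i => if s i then epsilon F G else - epsilon F G)) G.

(* The k-th word of {0,1}^m in lexicographic order is the binary expansion of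
   k, most significant digit first; digit k i is its entry at position i.  The
   sign words are ordered in the same way, with 0 read as - and 1 as +. *)
Definition digit (m : nat) (k : 'I_(2 ^ m)) (i : 'I_m) : nat :=
  (k %/ 2 ^ (m - i.+1)) %% 2.

Definition sign_at (m : nat) (k : 'I_(2 ^ m)) (i : 'I_m) : int :=
  if digit k i == 1%N then 1 else -1.

Definition sign_changes (s : seq int) : nat :=
  let s' := [seq x <- s | x != 0] in
  count (fun xy => xy.1 * xy.2 < 0) (zip s' (behead s')).

Definition Hmx (m : nat) : 'M[rat]_(2 ^ m) :=
  \matrix_(e, s) \prod_(i < m) (sign_at s i)%:~R ^+ digit e i.

Definition Vmx (m : nat) : 'M[rat]_(m, 2 ^ m) :=
  \matrix_(t, s)
    (sign_changes (rcons [seq sign_at s i | i : 'I_m <- enum 'I_m] 1)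
       == (m - t.+1)%N)%:R.

Definition C_sig (m : nat) : 'M[rat]_(m, 2 ^ m) := Vmx m *m invmx (Hmx m).

Definition f_pow (R : rcfType) (m : nat) (F : 'M[R]_m) (e : 'I_(2 ^ m)) :
    {poly R} :=
  \prod_(i < m) (char_poly F)^`(i) ^+ digit e i.

(* The size of G is a successor because evaluation of polynomials at a matrix
   requires the ring of matrices of nonzero size. *)
Definition A_sig (R : rcfType) (m n : nat) (F : 'M[R]_m) (G : 'M[R]_n.+1) :
    'cV[rat]_(2 ^ m) :=
  \col_e (signature (horner_mx G (f_pow F e)))%:~R.

Lemma count_mem_eigenvalues (R : rcfType) (n : nat) (A : 'M[R]_n) (x : R) :
  count_mem x (eigenvalues A) = mup x (char_poly A).
Proof.
have p0 : char_poly A != 0 by rewrite monic_neq0 ?char_poly_monic.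
have mem y : (y \in rootsR (char_poly A)) = root (char_poly A) y.
  by rewrite -(roots_on_rootsR p0).
have u : uniq (rootsR (char_poly A)) by exact: uniq_roots.
rewrite /eigenvalues count_flatten -map_comp sumnE big_map.
rewrite (eq_bigr (fun y => if y == x then mup x (char_poly A) else 0%N)).
  rewrite -big_mkcond /=; have [rx|nrx] := boolP (root (char_poly A) x).
    by rewrite -big_filter filter_pred1_uniq ?mem // big_seq1.
  rewrite big1_seq ?mupNroot // => y /andP[/eqP -> ].
by move=> y _ /=; rewrite count_nseq /=; case: eqP => [->|]; rewrite ?mul1n ?mul0n.
Qed.

Lemma eigenvalues_sorted (R : rcfType) (n : nat) (A : 'M[R]_n) :
  sorted <=%O (eigenvalues A).
Proof.
rewrite /eigenvalues; have: sorted <%O (rootsR (char_poly A)).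
  exact: sorted_roots.
elim: (rootsR _) => //= x s IHs.
rewrite !lt_path_sortedE => /andP[/allP xs /IHs ss].
have le_x y : y \in flatten [seq nseq (mup z (char_poly A)) z | z <- s] -> x <= y.
  case/flattenP=> _ /mapP[z zs ->]; rewrite mem_nseq => /andP[_ /eqP ->].
  exact/ltW/xs.
elim: (mup _ _) => //= k IHk; rewrite le_path_sortedE IHk andbT.
apply/allP=> y; rewrite mem_cat => /orP[|/le_x //].
by rewrite mem_nseq => /andP[_ /eqP ->].
Qed.

Lemma GEC_eigenvalues (R : rcfType) (m n : nat) (F F' : 'M[R]_m)
    (G : 'M[R]_n) :
  perm_eq (eigenvalues F) (eigenvalues F') -> GEC F G = GEC F' G.
Proof.
move=> /(sorted_eq le_trans le_anti (eigenvalues_sorted F)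
          (eigenvalues_sorted F')) eqF.
by apply/colP=> t; rewrite !mxE /in_A /alpha eqF.
Qed.

Lemma eigenvalues_perturbed (R : rcfType) (m : nat) (F : 'M[R]_m)
    (d : 'I_m -> R) :
  perm_eq (eigenvalues (perturbed F d)) [seq alpha F i + d i | i : 'I_m <- enum 'I_m].
Proof.
apply/allP=> x _; apply/eqP; rewrite count_mem_eigenvalues.
rewrite char_poly_trig ?diag_mx_is_trig //.
under eq_bigr => i _ do rewrite !mxE eqxx mulr1n.
rewrite -(big_map _ xpredT (fun a => 'X - a%:P)) /= -[index_enum _]enumT.
by rewrite mu_prod_XsubC.
Qed.

Lemma perturbed_sym (R : rcfType) (m : nat) (F : 'M[R]_m) (d : 'I_m -> R) :
  (perturbed F d)^T = perturbed F d.
Proof. exact: tr_diag_mx. Qed.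

(* Main.v *)
(* Both sides are sums over the eigenvalues b of G.  The term of b is the
   coefficient of degree m - t of a polynomial: on the left, the average over
   the perturbations of 'X to the number of perturbed eigenvalues of F above b;
   on the right, the average of 'X to the number of sign changes over all ways
   of replacing the zeros in f(b), f'(b), ..., f^(m)(b) by signs.  If b is
   a root of f of multiplicity mu with p roots above it, both polynomials equal
   'X^p * ((1 + 'X) / 2)^mu: the mu leading zeros of the sequence of derivatives
   contribute the binomial factor, and by Descartes' rule of signs, which is
   exact for real-rooted polynomials however vanishing coefficients are signed,
   the remaining derivatives contribute p sign changes. *)
Require Import Defs.
From HB Require Import structures.
From mathcomp Require Import all_boot all_order all_algebra.
From mathcomp Require Import polyrcf.
From mathcomp Require Import reals.
From mathcomp Require Import complex spectral mxred.
From mathcomp Require Import zify ring lra.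

Set Implicit Arguments.
Unset Strict Implicit.
Unset Printing Implicit Defensive.

Import Order.TTheory GRing.Theory Num.Theory.
Local Open Scope ring_scope.

(** * Spectrum and signature of a polynomial in a symmetric matrix *)

Lemma char_poly_uconjC (K : fieldType) (n : nat) (P A : 'M[K]_n) :
  P \in unitmx -> char_poly (invmx P *m A *m P) = char_poly A.
Proof.
move=> Pu; rewrite /char_poly.
have -> : char_poly_mx (invmx P *m A *m P) =
    map_mx polyC (invmx P) *m char_poly_mx A *m map_mx polyC P.
  rewrite /char_poly_mx mulmxBr mulmxBl !map_mxM; congr (_ - _).
  by rewrite scalar_mxC -mulmxA -map_mxM mulVmx // map_mx1 mulmx1.
rewrite !det_mulmx mulrAC -det_mulmx -map_mxM mulVmx //.
by rewrite map_mx1 det1 mul1r.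
Qed.

(** Over [R[i]] the matrix becomes Hermitian, hence is unitarily diagonalizable with real diagonal,
    and [p] acts on the diagonal entries. The identity descends because [R] embeds in [R[i]]. One
    list [rs] serves every [p], so that [p] and ['X] can be compared. *)
Lemma char_poly_horner_sym (R : rcfType) (n : nat) (G : 'M[R]_n.+1) :
  G^T = G ->
  exists rs : seq R, forall p : {poly R},
    char_poly (horner_mx G p) = \prod_(r <- rs) ('X - p.[r]%:P).
Proof.
move=> hG; pose toC := real_complex R : {rmorphism R -> R[i]%C}.
pose G' := map_mx toC G.
have G'herm : G' \is hermsymmx.
  apply: realsym_hermsym.
    apply/is_hermitianmxP.
    by rewrite expr0 scale1r map_mx_id // /G' map_trmx hG.
  by apply/mxOverP => i j; rewrite mxE; apply/complex_realP; exists (G i j).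
have /orthomx_spectralP := hermitian_normalmx G'herm.
have := hermitian_spectral_diag_real G'herm.
set P := spectralmx G'; set sp := spectral_diag G' => spR G'E.
have Pu : P \in unitmx := spectral_unit G'.
pose r i := complex.Re (sp 0 i).
have spE : sp = map_mx toC (\row_i r i).
  apply/rowP => i; rewrite !mxE; apply/esym/RRe_real; exact: (mxOverP spR).
exists [seq r i | i <- enum 'I_n.+1] => p.
apply: (map_poly_inj toC); rewrite map_char_poly map_horner_mx -/G' G'E.
rewrite horner_mx_uconjC // char_poly_uconjC // spE horner_mx_diag.
rewrite char_poly_trig ?diag_mx_is_trig // big_map enumT rmorph_prod.
apply: eq_bigr => i _ /=.
by rewrite !mxE eqxx mulr1n horner_map rmorphB /= map_polyX map_polyC.
Qed.

Lemma perm_eigenvalues (R : rcfType) (n : nat) (A : 'M[R]_n) (rs : seq R) :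
  char_poly A = \prod_(r <- rs) ('X - r%:P) -> perm_eq (eigenvalues A) rs.
Proof.
move=> chA; apply/allP=> x _; apply/eqP.
by rewrite count_mem_eigenvalues chA mu_prod_XsubC.
Qed.

Lemma char_poly_sym (R : rcfType) (n : nat) (G : 'M[R]_n.+1) :
  G^T = G -> char_poly G = \prod_(r <- eigenvalues G) ('X - r%:P).
Proof.
move=> /char_poly_horner_sym[rs /(_ 'X)]; rewrite horner_mx_X => chG.
have chG' : char_poly G = \prod_(r <- rs) ('X - r%:P).
  by rewrite chG; apply: eq_bigr => r _; rewrite hornerX.
by rewrite (perm_big _ (perm_eigenvalues chG')).
Qed.

Lemma perm_eigenvalues_horner (R : rcfType) (n : nat) (G : 'M[R]_n.+1)
    (p : {poly R}) :
  G^T = G -> perm_eq (eigenvalues (horner_mx G p)) (map (horner p) (eigenvalues G)).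
Proof.
move=> /char_poly_horner_sym[rs chG].
have chp : char_poly (horner_mx G p) = \prod_(r <- map (horner p) rs) ('X - r%:P).
  by rewrite chG big_map.
apply: (perm_trans (perm_eigenvalues chp)); apply: perm_map.
rewrite perm_sym; apply: perm_eigenvalues; rewrite -[G in LHS]horner_mx_X chG.
by apply: eq_bigr => r _; rewrite hornerX.
Qed.

Lemma signature_horner (R : rcfType) (n : nat) (G : 'M[R]_n.+1) (p : {poly R}) :
  G^T = G -> signature (horner_mx G p) = \sum_(r <- eigenvalues G) sgz p.[r].
Proof.
move=> hG; rewrite /signature !(permP (perm_eigenvalues_horner p hG)).
rewrite -(big_map _ xpredT (@sgz R)).
elim: (map _ _) => [|x s IHs]; first by rewrite big_nil.
rewrite big_cons -IHs /= !PoszD; case: sgzP => x0 /=.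
- by rewrite !add0r.
- by rewrite addrA.
by rewrite opprD addrCA.
Qed.

(** * Sign variations and Descartes' rule for real-rooted polynomials *)

Definition variations (w : seq bool) : nat :=
  count (fun xy => xy.1 != xy.2) (zip w (behead w)).

Lemma variations_cons2 (x y : bool) (w : seq bool) :
  variations [:: x, y & w] = ((x != y) + variations (y :: w))%N.
Proof. by []. Qed.

(* Entries at which [c] vanishes may carry either sign. *)
Definition agrees (R : realDomainType) (w : seq bool) (c : nat -> R) : Prop :=
  forall k, (k < size w)%N -> 0 <= if nth true w k then c k else - c k.

Lemma agrees_cons (R : realDomainType) (x : bool) (w : seq bool) (c : nat -> R) :
  agrees (x :: w) c <-> 0 <= (if x then c 0%N else - c 0%N) /\ agrees w (c \o succn).
Proof.
split=> [H | [H0 H1] [|k]] //; last exact: (H1 k).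
by split=> [|k]; [exact: (H 0%N) | exact: (H k.+1)].
Qed.

Lemma agrees_ext (R : realDomainType) (w : seq bool) (c c' : nat -> R) :
  c =1 c' -> agrees w c -> agrees w c'.
Proof. by move=> cc' H k /H; rewrite cc'. Qed.

Lemma agrees_pos (R : realDomainType) (x : bool) (c : R) :
  0 <= (if x then c else - c) -> 0 < c -> x.
Proof. by case: x => //; rewrite oppr_ge0 leNgt => /negPf->. Qed.

Lemma agrees_neg (R : realDomainType) (x : bool) (c : R) :
  0 <= (if x then c else - c) -> c < 0 -> ~~ x.
Proof. by case: x => //; rewrite leNgt => /negPf->. Qed.

(* [g] lists the coefficients of a polynomial and [a] is a positive root being
   factored in; [c0] is the coefficient preceding those of [g]. *)
Lemma variations_descent (R : realDomainType) (a : R) (g : seq R) (c0 : R)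
    (x : bool) (w : seq bool) :
  0 < a -> size w = size g ->
  agrees (x :: w) (fun k => nth 0 (c0 :: g) k - a * nth 0 g k) ->
  exists x' w', [/\ size w' = size g, agrees (x' :: w') (nth 0 (c0 :: g))
    & ((x' != x) + variations (x' :: w') <= variations (x :: w))%N].
Proof.
move=> a_gt0; elim: g c0 x w => [|g0 g IHg] c0 x w.
  move=> /size0nil-> /agrees_cons[/= c0P _]; exists x, [::].
  by rewrite eqxx; split=> //; apply/agrees_cons; rewrite mulr0 subr0 in c0P.
case: w => [//|y w] [sz] /agrees_cons[/= c0P yP].
have [y' [w' [sz' y'P le_var]]] := IHg g0 y w sz yP.
have [g0P _] := (agrees_cons _ _ _).1 y'P.
rewrite /= in g0P; rewrite variations_cons2.
(* Either [c0] can bear the sign [y'], or it has strictly the opposite sign; then [c0 - a * g0] has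
   the sign of [c0], which forces [x = ~~ y']. Both bounds are the triangle inequality between the
   signs [x], [y] and [y']. *)
have take_y' : 0 <= (if y' then c0 else - c0) ->
    exists x2 w2, [/\ size w2 = (size g).+1,
      agrees (x2 :: w2) (nth 0 [:: c0, g0 & g])
    & ((x2 != x) + variations (x2 :: w2) <= (x != y) + variations (y :: w))%N].
  move=> y'c0; exists y', (y' :: w'); split;
    [by rewrite /= sz' | by apply/agrees_cons |].
  rewrite variations_cons2 eqxx.
  by case: (x) (y) (y') le_var => [] [] []; lia.
have take_x : x = ~~ y' -> 0 <= (if x then c0 else - c0) ->
    exists x2 w2, [/\ size w2 = (size g).+1,
      agrees (x2 :: w2) (nth 0 [:: c0, g0 & g])
    & ((x2 != x) + variations (x2 :: w2) <= (x != y) + variations (y :: w))%N].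
  move=> xE xc0; exists x, (y' :: w'); split;
    [by rewrite /= sz' | by apply/agrees_cons |].
  by rewrite variations_cons2 eqxx xE; case: (y) (y') le_var => [] []; lia.
have [c0_lt0|c0_gt0|c0_eq0] := ltgtP c0 0.
- case: (y') g0P take_y' take_x => /= g0P take_y' take_x.
    have /negPf x0 : ~~ x.
      apply: agrees_neg c0P _; rewrite subr_lt0 (lt_le_trans c0_lt0) //.
      by rewrite mulr_ge0 // ltW.
    by apply: take_x; rewrite x0 // oppr_ge0 ltW.
  by apply: take_y'; rewrite oppr_ge0 ltW.
- case: (y') g0P take_y' take_x => /= g0P take_y' take_x.
    by apply: take_y'; rewrite ltW.
  have xT : x.
    apply: agrees_pos c0P _; rewrite subr_gt0 (le_lt_trans _ c0_gt0) //.
    by rewrite mulr_ge0_le0 ?(ltW a_gt0) // -oppr_ge0.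
  by apply: take_x; rewrite xT // ltW.
by apply: take_y'; rewrite c0_eq0 oppr0 if_same.
Qed.

Lemma agrees_coef_XsubC (R : realDomainType) (a : R) (g : {poly R}) w :
  agrees w (fun k => (('X - a%:P) * g)`_k) ->
  agrees w (fun k => nth 0 (0 :: g) k - a * g`_k).
Proof.
apply: agrees_ext => k; rewrite mulrBl coefB coefXM coefCM.
by case: k.
Qed.

(** Dividing out ['X - a] loses at least one variation: the descent loses none, and the constant
    coefficients [b] of the quotient and [- a * b] of the product have strictly opposite signs. The
    condition on [h] keeps them nonzero throughout the induction. *)
Lemma variations_ge_posroots (R : realDomainType) (h : {poly R}) (s : seq R)
    (w : seq bool) :
  h`_0 != 0 -> all (fun a => 0 < a) s ->
  let f := h * \prod_(a <- s) ('X - a%:P) in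
  size w = size f -> agrees w (nth 0 f) -> (size s <= variations w)%N.
Proof.
move=> h0 + /=; elim: s w => [//|a s IHs] w /= /andP[a_gt0 s_gt0].
rewrite big_cons mulrCA; set g := h * _ in IHs *.
have g0 : g`_0 != 0.
  rewrite /g -!horner_coef0 hornerM horner_prod mulf_neq0 ?horner_coef0 //.
  rewrite prodf_seq_neq0; apply/allP => b /(allP s_gt0) b_gt0 /=.
  by rewrite hornerXsubC sub0r oppr_eq0 gt_eqF.
have gN0 : g != 0 by apply: contraNneq g0 => ->; rewrite coef0.
rewrite mulrC size_Mmonic ?monicXsubC // size_XsubC addn2 /= mulrC.
case: w => [//|x w] [sz] /agrees_coef_XsubC.
move=> /agrees_cons[/= x0 wP].
case: (polyseq g) g0 IHs sz x0 wP => [|b bs] /=; first by rewrite eqxx.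
rewrite sub0r; case: w => [//|y w] b0 IHs [sz] x0 wP.
have [x' [w' [sz' w'P le_var]]] := variations_descent a_gt0 sz wP.
apply: (@leq_ltn_trans (variations (x' :: w'))).
  by apply: IHs; rewrite //= sz'.
have [/= x'b _] := (agrees_cons _ _ _).1 w'P.
have x'x : x = ~~ x'.
  case/orP: (lt_total b0) => b_sg; [have x'E := negPf (agrees_neg x'b b_sg)|
     have x'E := agrees_pos x'b b_sg]; rewrite x'E.
    by apply: agrees_pos x0 _; rewrite oppr_gt0 pmulr_rlt0.
  by apply/negbTE; apply: agrees_neg x0 _; rewrite oppr_lt0 mulr_gt0.
rewrite variations_cons2 x'x; move: le_var.
by case: (x') (y) => [] []; lia.
Qed.

Lemma variations_ge_count (R : realDomainType) (s : seq R) (w : seq bool) :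
  0 \notin s -> size w = (size s).+1 ->
  agrees w (nth 0 (\prod_(a <- s) ('X - a%:P))) ->
  (count (fun a => 0 < a)%R s <= variations w)%N.
Proof.
move=> s0 szw; have sE := permEl (perm_filterC (fun a => 0 < a) s).
rewrite -(perm_big _ sE) big_cat /= mulrC => wP.
rewrite -size_filter; apply: variations_ge_posroots wP.
- rewrite -horner_coef0 horner_prod prodf_seq_neq0; apply/allP => a.
  rewrite mem_filter /= hornerXsubC sub0r oppr_eq0 => /andP[_ sa].
  by apply: contraNneq s0 => <-.
- exact: filter_all.
by rewrite mulrC -big_cat (perm_big _ sE) size_prod_XsubC.
Qed.

Lemma coef_prod_XsubC_opp (R : comNzRingType) (s : seq R) (k : nat) :
  (\prod_(a <- map -%R s) ('X - a%:P))`_k =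
  (-1) ^+ (size s + k) * (\prod_(a <- s) ('X - a%:P))`_k.
Proof.
elim: s k => [|a s IHs] k.
  by rewrite !big_nil coef1; case: k => [|k]; rewrite ?mulr0 // mul1r.
have comb (e p q : R) : e * p - - a * (-1 * e * q) = -1 * (-1 * e) * (p - a * q).
  ring.
rewrite /= !big_cons !mulrBl !coefB !coefXM !coefCM !IHs.
case: k => [|k]; rewrite ?addn0 ?addSn ?addnS !exprS; last exact: comb.
by rewrite /= !sub0r mulN1r mulrN !mulNr !opprK mulrCA.
Qed.

(** Effect of [x |-> - x] on the signs of coefficients; [b] carries the global sign, which is the
    parity of the degree when the result is made monic. *)
Fixpoint alternate (b : bool) (w : seq bool) : seq bool :=
  if w is x :: w' then (x (+) b) :: alternate (~~ b) w' else [::].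

Lemma size_alternate b w : size (alternate b w) = size w.
Proof. by elim: w b => //= x w IHw b; rewrite IHw. Qed.

Lemma nth_alternate b w k : (k < size w)%N ->
  nth true (alternate b w) k = nth true w k (+) (b (+) odd k).
Proof.
elim: w b k => // x w IHw b [|k] /= kw; first by rewrite addbF.
by rewrite IHw // addNb -addbN.
Qed.

(** Each pair of neighbours differs in exactly one of the two words. *)
Lemma variations_alternate b w :
  (variations (alternate b w) + variations w)%N = (size w).-1.
Proof.
elim: w b => [//|x [//|y w] IHw] b.
rewrite [alternate _ _]/= !variations_cons2 addnACA.
by rewrite (IHw (~~ b)) {IHw}; case: x y b => [] [] [].
Qed.

(* Descartes' bound is applied to the polynomial and to its image under
   [x |-> - x]; for a real-rooted polynomial the two bounds add up to the
   degree, so both are attained, whatever signs the zero coefficients get. *)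
Lemma variations_real_rooted (R : realDomainType) (s : seq R) (w : seq bool) :
  0 \notin s -> size w = (size s).+1 ->
  agrees w (nth 0 (\prod_(a <- s) ('X - a%:P))) ->
  variations w = count (fun a => 0 < a) s.
Proof.
move=> s0 szw wP; apply/eqP; rewrite eqn_leq variations_ge_count // andbT.
have : (count (fun a => 0 < a)%R (map -%R s) <=
        variations (alternate (odd (size s)) w))%N.
  apply: variations_ge_count.
  - by apply: contra s0 => /mapP[a sa /esym/eqP]; rewrite oppr_eq0 => /eqP <-.
  - by rewrite size_alternate size_map.
  move=> k; rewrite size_alternate => kw; have := wP k kw.
  rewrite coef_prod_XsubC_opp nth_alternate // -signr_odd oddD.
  case: (nth true w k) (odd (size s) (+) odd k) => [] [];
    by rewrite ?expr0 ?expr1 ?mulN1r ?opprK ?mul1r.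
have := variations_alternate (odd (size s)) w; rewrite szw /= => varD.
have : (count (fun a => 0 < a)%R s + count (fun a => 0 < a)%R (map -%R s))%N = size s.
  rewrite count_map -(count_predC (fun a => 0 < a)%R); congr (_ + _)%N.
  apply: eq_in_count => a sa /=; rewrite oppr_gt0 -leNgt le_eqVlt.
  by have /negPf-> : a != 0 by apply: contraNneq s0 => <-.
move=> countD le_alt; rewrite -(leq_add2l (variations (alternate (odd (size s)) w))).
by rewrite varD -[leqLHS]countD addnC leq_add2r.
Qed.

(** * Binary words and the inverse of [Hmx] *)

Lemma eq_from_bits (m k l : nat) : (k < 2 ^ m)%N -> (l < 2 ^ m)%N ->
  (forall j, (j < m)%N -> odd (k %/ 2 ^ j) = odd (l %/ 2 ^ j)) -> k = l.
Proof.
elim: m k l => [|m IHm] k l; first by rewrite expn0 !ltnS !leqn0 => /eqP-> /eqP->.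
rewrite expnS mul2n => ltk ltl bits.
rewrite -(odd_double_half k) -(odd_double_half l).
have := bits 0%N isT; rewrite expn0 !divn1 => ->; congr (_ + _.*2)%N.
apply: IHm => [||j ltj]; rewrite -?divn2 ?ltn_divLR ?muln2 //.
by rewrite -!divnMA -expnS; apply: bits.
Qed.

Definition bits (m : nat) (k : 'I_(2 ^ m)) : {ffun 'I_m -> bool} :=
  [ffun i => digit k i == 1%N].

Lemma digitE (m : nat) (k : 'I_(2 ^ m)) (i : 'I_m) : digit k i = bits k i.
Proof. by rewrite ffunE /digit modn2; case: odd. Qed.

Lemma bits_bij (m : nat) : bijective (@bits m).
Proof.
apply: inj_card_bij => [k l /ffunP eq_kl|]; last first.
  by rewrite card_ffun card_bool !card_ord.
apply/val_inj/(@eq_from_bits m); [exact: ltn_ord | exact: ltn_ord | move=> j ltj].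
have ltr : (m - j.+1 < m)%N by lia.
have := congr1 nat_of_bool (eq_kl (Ordinal ltr)); rewrite -!digitE /digit !modn2 /=.
have -> : (m - (m - j.+1).+1 = j)%N by lia.
by case: odd; case: odd.
Qed.

Definition sgb (b : bool) : rat := if b then 1 else -1.

Lemma sign_atE (m : nat) (k : 'I_(2 ^ m)) (i : 'I_m) :
  sign_at k i = if bits k i then 1 else -1.
Proof. by rewrite ffunE. Qed.

Lemma sign_at_rat (m : nat) (k : 'I_(2 ^ m)) (i : 'I_m) :
  (sign_at k i)%:~R = sgb (bits k i).
Proof. by rewrite sign_atE /sgb; case: (bits k i). Qed.

Lemma sum_prod_bits (S : comNzRingType) (m : nat) (G : 'I_m -> bool -> S) :
  \sum_(k : 'I_(2 ^ m)) \prod_i G i (bits k i) =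
  \prod_i (G i false + G i true).
Proof.
have [g bitsK gK] := bits_bij m.
rewrite (reindex g) /=; last by apply/onW_bij; exists (@bits m).
under eq_bigr => s _ do rewrite gK.
rewrite -bigA_distr_bigA; apply: eq_bigr => i _.
by rewrite big_bool /= addrC.
Qed.

(** [Hmx m] is the m-fold Kronecker power of the matrix with rows (1, 1) and (-1, 1), whose inverse
    is half its transpose. Accordingly the product with the candidate inverse factors over the
    positions, and each factor is a Kronecker delta. *)
Lemma invmx_Hmx (m : nat) :
  invmx (Hmx m) = \matrix_(s, e) \prod_i (sgb (bits s i) ^+ bits e i / 2).
Proof.
set K := (X in _ = X); suff HK : Hmx m *m K = 1%:M.
  by have [Hu _] := mulmx1_unit HK; rewrite -[RHS](mulKmx Hu) HK mulmx1.
apply/matrixP => e e'; rewrite !mxE.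
pose G i b : rat := sgb b ^+ bits e i * (sgb b ^+ bits e' i / 2).
rewrite (eq_bigr (fun s => \prod_i G i (bits s i))) => [|s _]; last first.
  rewrite !mxE -big_split /=; apply: eq_bigr => i _.
  by rewrite sign_at_rat digitE.
rewrite sum_prod_bits.
have -> : (e == e') = [forall i, bits e i == bits e' i].
  rewrite -(inj_eq (bij_inj (bits_bij m))).
  by apply/eqP/eqfunP => [->|/ffunP].
transitivity (\prod_i ((bits e i == bits e' i)%:R : rat)).
  apply: eq_bigr => i _; rewrite /G /sgb.
  by case: (bits e i) (bits e' i) => [] []; rewrite /= ?expr0 ?expr1; field.
case: eqfunP => [eqs|neqs]; first by rewrite big1 // => i _; rewrite eqs eqxx.
have [i neqi] : exists i, bits e i != bits e' i.
  apply/existsP; rewrite -negb_forall; apply/negP => /eqfunP; exact: neqs.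
by rewrite (bigD1 i) //= (negPf neqi) mul0r.
Qed.

(** * Average of the sign variations over random completions of zeros *)

Definition fcons (m : nat) (b : bool) (s : {ffun 'I_m -> bool}) :
    {ffun 'I_m.+1 -> bool} :=
  [ffun i => if unlift ord0 i is Some j then s j else b].

Lemma fcons0 m b (s : {ffun 'I_m -> bool}) : fcons b s ord0 = b.
Proof. by rewrite ffunE unlift_none. Qed.

Lemma fconsS m b (s : {ffun 'I_m -> bool}) i : fcons b s (lift ord0 i) = s i.
Proof. by rewrite ffunE liftK. Qed.

Lemma big_fcons (V : nmodType) (m : nat) (phi : {ffun 'I_m.+1 -> bool} -> V) :
  \sum_s phi s = \sum_b \sum_s phi (fcons b s).
Proof.
rewrite pair_bigA /= (reindex (fun p => fcons p.1 p.2)) //.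
apply/onW_bij; exists (fun s : {ffun 'I_m.+1 -> bool} =>
    (s ord0, [ffun i => s (lift ord0 i)])).
  by case=> b s /=; rewrite fcons0; congr pair; apply/ffunP => i; rewrite ffunE fconsS.
move=> s; apply/ffunP => i; rewrite ffunE /=.
by case: unliftP => [j|] ->; rewrite ?ffunE.
Qed.

Definition word (m : nat) (s : {ffun 'I_m -> bool}) : seq bool :=
  [seq s i | i <- enum 'I_m].

Lemma word_fcons m b (s : {ffun 'I_m -> bool}) : word (fcons b s) = b :: word s.
Proof.
rewrite /word enum_ordSl /= fcons0 -map_comp; congr (_ :: _).
by apply: eq_map => i /=; rewrite fconsS.
Qed.

(** For [sigma] with values in {-1, 0, 1}, this is the probability of [s] when entry [i] is the sign
    [sigma i] if that is nonzero and an independent fair coin otherwise. *)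
Definition weight (m : nat) (sigma : 'I_m -> rat) (s : {ffun 'I_m -> bool}) :=
  \prod_i ((1 + sgb (s i) * sigma i) / 2).

Lemma sum_weight m (sigma : 'I_m -> rat) : \sum_s weight sigma s = 1.
Proof.
rewrite /weight -(bigA_distr_bigA (fun i b => (1 + sgb b * sigma i) / 2)) big1 // => i _.
by rewrite big_bool /sgb /=; field.
Qed.

(** Generating polynomial of the number of variations of the random word. The appended [true] is the
    sign of the leading coefficient of a monic polynomial, and also the + appended in [Vmx]. *)
Definition variation_poly (m : nat) (sigma : 'I_m -> rat) : {poly rat} :=
  \sum_s weight sigma s *: 'X^(variations (rcons (word s) true)).

(** A leading zero is a fair coin: whatever sign follows, exactly one of its two values adds a
    variation. A following sign always exists, thanks to the appended one. *)
Lemma variation_poly0 m (sigma : 'I_m.+1 -> rat) : sigma ord0 = 0 ->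
  variation_poly sigma =
  2^-1 *: (1 + 'X) * variation_poly (sigma \o lift ord0).
Proof.
move=> sigma0; rewrite /variation_poly big_fcons exchange_big mulr_sumr.
apply: eq_bigr => s _; rewrite big_bool /= !word_fcons.
have wE b : weight sigma (fcons b s) = 2^-1 * weight (sigma \o lift ord0) s.
  rewrite /weight big_ord_recl sigma0 mulr0 addr0 mul1r; congr (_ * _).
  by apply: eq_bigr => i _; rewrite fconsS.
rewrite !wE -scalerDr -!scalerA -scalerAl -scalerAr; do 2 congr (_ *: _).
rewrite !rcons_cons; case: (rcons _ _) (size_rcons (word s) true) => [//|y w] _.
rewrite mulrDl mul1r -exprS !variations_cons2.
by case: y; last exact: addrC.
Qed.

(** Every word of nonzero weight agrees with the coefficients, hence has the same number of
    variations by Descartes' rule; the weights add up to 1. *)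
Lemma variation_poly_nonroot (R : realDomainType) (m : nat) (s : seq R)
    (sigma : 'I_m -> rat) :
  size s = m -> 0 \notin s ->
  (forall i, sigma i = (sgz (\prod_(a <- s) ('X - a%:P))`_i)%:~R) ->
  variation_poly sigma = 'X^(count (fun a => 0 < a) s).
Proof.
move=> szs s0 sigmaE; case: m / szs in sigma sigmaE *.
rewrite -[RHS]scale1r -(sum_weight sigma) scaler_suml.
apply: eq_bigr => w _; have [->|W0] := eqVneq (weight sigma w) 0.
  by rewrite !scale0r.
congr (_ *: 'X^_); apply: variations_real_rooted => //.
  by rewrite size_rcons size_map size_enum_ord.
move=> k; rewrite size_rcons size_map size_enum_ord ltnS leq_eqVlt.
rewrite nth_rcons size_map size_enum_ord.
case/predU1P=> [->|ltk].
  (* The appended [true] faces the leading coefficient, which is 1. *)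
  have /monicP := monic_prod_XsubC s xpredT id.
  by rewrite lead_coefE size_prod_XsubC ltnn eqxx /= => ->.
rewrite ltk (nth_map (Ordinal ltk)) ?size_enum_ord //.
set i := Ordinal ltk; have -> : nth (Ordinal ltk) (enum 'I_(size s)) k = i.
  by apply: val_inj; rewrite /= nth_enum_ord.
(* A nonzero factor at [i] excludes the sign opposite to [sigma i]. *)
move: W0; rewrite /weight (bigD1 i) //= mulf_eq0 negb_or => /andP[+ _].
have -> : sigma i = (sgz (\prod_(a <- s) ('X - a%:P))`_k)%:~R := sigmaE i.
move: (_`_k) => c; rewrite mulf_eq0 negb_or /sgb => /andP[+ _].
by case: (w i); case: sgzP => /= [c0|c_gt0|c_lt0] //;
  rewrite ?c0 ?oppr0 ?oppr_ge0 ?(ltW c_lt0) //.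
Qed.

(** Each root 0 contributes a factor ['X], which shifts the coefficients and leaves a leading zero
    for [variation_poly0] to remove. *)
Lemma variation_poly_real_rooted (R : realDomainType) (m : nat) (s : seq R)
    (sigma : 'I_m -> rat) :
  size s = m ->
  (forall i, sigma i = (sgz (\prod_(a <- s) ('X - a%:P))`_i)%:~R) ->
  variation_poly sigma = 'X^(count (fun a => 0 < a) s) *
    (2^-1 *: (1 + 'X)) ^+ count_mem 0 s.
Proof.
elim: m s sigma => [|m IHm] s sigma szs sigmaE.
  have s0 : 0 \notin s by rewrite (size0nil szs).
  rewrite (count_memPn s0) expr0 mulr1.
  exact: variation_poly_nonroot szs s0 sigmaE.
have [s0|s0] := boolP (0 \in s); last first.
  rewrite (count_memPn s0) expr0 mulr1.
  exact: variation_poly_nonroot szs s0 sigmaE.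
have sE := perm_to_rem s0; rewrite !(permP sE) /= ltxx eqxx add0n exprS.
have prodE i : (\prod_(a <- s) ('X - a%:P))`_i =
    if i is j.+1 then (\prod_(a <- rem 0 s) ('X - a%:P))`_j else 0.
  by rewrite (perm_big _ sE) big_cons subr0 coefXM; case: i.
rewrite variation_poly0; last by rewrite sigmaE prodE sgz0.
rewrite (IHm (rem 0 s)) ?size_rem ?szs // => [|i]; first by rewrite mulrCA.
by rewrite /= sigmaE prodE.
Qed.

(** Taylor expansion: coefficient [k] of [f \Po ('X + b%:P)] is the [k]-th derivative at [b] divided
    by [k!], and the translation moves each root [a] to [a - b]. *)
Lemma sgz_derivn_prod_XsubC (R : realDomainType) (s : seq R) (b : R) (k : nat) :
  sgz (\prod_(a <- s) ('X - a%:P))^`(k).[b] =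
  sgz (\prod_(a <- [seq a - b | a <- s]) ('X - a%:P))`_k.
Proof.
set f := \prod_(a <- s) _; pose q : {poly R} := 'X + b%:P.
have -> : \prod_(a <- [seq a - b | a <- s]) ('X - a%:P) = f \Po q.
  rewrite big_map rmorph_prod; apply: eq_bigr => a _.
  by rewrite [RHS]comp_polyB comp_polyX comp_polyC polyCB opprB addrA addrAC.
have dq j : f^`(j) \Po q = (f \Po q)^`(j).
  elim: j => [|j IHj]; first by rewrite !derivn0.
  by rewrite !derivnS -IHj deriv_comp derivD derivX derivC addr0 mulr1.
have -> : f^`(k).[b] = (f^`(k) \Po q).[0].
  by rewrite horner_comp hornerD hornerX hornerC add0r.
rewrite dq horner_coef0 coef_derivn addn0 ffactnn -mulr_natr sgzM.
by rewrite [sgz _%:R]gtr0_sgz ?mulr1 // ltr0n fact_gt0.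
Qed.

(** * Eigenvalue intervals and the average over perturbations *)

Lemma nth_lt_count (d : Order.disp_t) (T : orderType d) (x0 x : T) (s : seq T) (i : nat) :
  sorted <=%O s -> (i < size s)%N ->
  (nth x0 s i < x)%O = (i < count (fun a => a < x)%O s)%N.
Proof.
elim: s i => [//|a s IHs] i /=; rewrite le_path_sortedE => /andP[/allP as_ ss].
case: i => [|i]; rewrite ?ltnS => lti /=.
  case: (ltP a x) => //= xa; rewrite (eq_in_count (a2 := pred0)) ?count_pred0 //.
  by move=> b /as_ ab; apply/negbTE; rewrite -leNgt (le_trans xa).
rewrite IHs //; case: (ltP a x) => //= xa.
rewrite (eq_in_count (a2 := pred0)) ?count_pred0 //.
by move=> b /as_ ab; apply/negbTE; rewrite -leNgt (le_trans xa).
Qed.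

(** The point lies in interval [t] iff exactly [t.+1] eigenvalues are below it. Counting those above
    makes the test independent of sorting and gives the exponent [m - t.+1] of [Vmx]. *)
Lemma in_A_count (R : rcfType) (m : nat) (F : 'M[R]_m) (t : 'I_m) (x : R) :
  size (eigenvalues F) = m -> x \notin eigenvalues F ->
  in_A F t x = (count (fun a => x < a)%R (eigenvalues F) == m - t.+1)%N.
Proof.
move=> szF xF; rewrite /in_A /alpha.
set s := eigenvalues F in szF xF *.
have ss : sorted <=%O s := eigenvalues_sorted F.
have countD : (count (fun a => a < x)%R s + count (fun a => x < a)%R s = m)%N.
  rewrite -szF -(count_predC (fun a => a < x)%R); congr (_ + _)%N.
  apply: eq_in_count => a sa /=; rewrite -leNgt lt_neqAle.
  by have -> : x != a by apply: contraNneq xF => ->.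
rewrite nth_lt_count ?szF //.
(* For the last [t] the missing upper bound is automatic in terms of counts, since at most [m]
   eigenvalues are below [x]. *)
have -> : ((t.+1 < m)%N ==> (x < nth 0 s t.+1)) =
    ((t.+1 < m) ==> ~~ (t.+1 < count (fun a => a < x)%R s))%N.
  case: ltnP => //= ltm; rewrite -(nth_lt_count 0) ?szF // -leNgt lt_neqAle.
  by have -> : x != nth 0 s t.+1 by apply: contraNneq xF => ->; rewrite mem_nth ?szF.
move: countD (ltn_ord t).
move: (count _ s) (count _ s) => c c' cc' ltm; lia.
Qed.

(** The members [a] and [b] make the list of distances nonempty; on an empty list [epsilon] would be
    0. *)
Lemma epsilon_gt0 (R : rcfType) (m n : nat) (F : 'M[R]_m) (G : 'M[R]_n) (a b : R) :
  a \in eigenvalues F -> b \in eigenvalues G -> 0 < epsilon F G.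
Proof.
move=> Fa Gb; rewrite /epsilon; set ds := [seq _ | _ <- _, _ <- _].
have ds_gt0 d : d \in ds -> 0 < d.
  case/allpairsP=> -[a' b'] [_ _ ->]; rewrite /delta /=.
  by case: eqVneq => // ab; rewrite normr_gt0 subr_eq0.
rewrite mulr_gt0 ?invr_gt0 // big_seq; elim/big_ind: _ => //.
  have: delta a b \in ds by apply: allpairs_f.
  by case: ds ds_gt0 => // d ds ds_gt0 _; apply: ds_gt0; rewrite mem_head.
by move=> x y x0 y0; rewrite lt_min x0.
Qed.

Lemma epsilon_lt (R : rcfType) (m n : nat) (F : 'M[R]_m) (G : 'M[R]_n) (a b : R) :
  a \in eigenvalues F -> b \in eigenvalues G -> a != b ->
  epsilon F G < `|a - b|.
Proof.
move=> Fa Gb ab; have := epsilon_gt0 Fa Gb.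
rewrite /epsilon; set ds := [seq _ | _ <- _, _ <- _] => e_gt0.
have ds_ab : `|a - b| \in ds.
  by have := allpairs_f (@delta R) Fa Gb; rewrite /delta (negPf ab).
suff : \big[Num.min/head 0 ds]_(d <- ds) d <= `|a - b| by lra.
(* The neutral element is generalized, as it must stay fixed while the list shrinks. *)
elim: ds {1}(head 0 ds) ds_ab {e_gt0} => [//|d ds IHds] d0.
by rewrite big_cons inE ge_min => /predU1P[->|/IHds->]; rewrite ?lexx ?orbT.
Qed.

Definition shift (R : rcfType) (m n : nat) (F : 'M[R]_m) (G : 'M[R]_n) (b : bool) : R :=
  if b then epsilon F G else - epsilon F G.

Lemma shift_neq (R : rcfType) (m n : nat) (F : 'M[R]_m) (G : 'M[R]_n) (a b : R)
    (x : bool) :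
  a \in eigenvalues F -> b \in eigenvalues G -> a + shift F G x != b.
Proof.
move=> Fa Gb; have e_gt0 := epsilon_gt0 Fa Gb.
have := epsilon_lt Fa Gb; rewrite /shift.
move: (epsilon F G) e_gt0 => e e_gt0.
have [->|_ /(_ isT)] := eqVneq a b.
  by move=> _; case: x; apply/eqP => /= ?; lra.
by case: (ger0P (a - b)) => ?; case: x => ?; apply/eqP => /= ?; lra.
Qed.

(** The shift is smaller than every nonzero gap, so it preserves strict comparisons and breaks a tie
    in the direction of [x]. *)
Lemma lt_shift (R : rcfType) (m n : nat) (F : 'M[R]_m) (G : 'M[R]_n) (a b : R)
    (x : bool) :
  a \in eigenvalues F -> b \in eigenvalues G ->
  (b < a + shift F G x) = if x then b <= a else b < a.
Proof.
move=> Fa Gb; have e_gt0 := epsilon_gt0 Fa Gb.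
have := epsilon_lt Fa Gb; rewrite /shift.
move: (epsilon F G) e_gt0 => e e_gt0.
have [->|_ /(_ isT)] := eqVneq a b.
  by move=> _; case: x; apply/idP/idP => /= ?; lra.
by case: (ger0P (a - b)) => ?; case: x => ? ; apply/idP/idP => /= ?; lra.
Qed.

Lemma eigenvalues_alpha (R : rcfType) (m : nat) (F : 'M[R]_m) :
  size (eigenvalues F) = m -> eigenvalues F = [seq alpha F i | i : 'I_m <- enum 'I_m].
Proof.
move=> szF; rewrite -[LHS](mkseq_nth 0) /mkseq szF -val_enum_ord -map_comp.
exact: eq_map.
Qed.

Lemma size_eigenvalues_sym (R : rcfType) (m : nat) (F : 'M[R]_m.+1) :
  F^T = F -> size (eigenvalues F) = m.+1.
Proof.
move=> /char_poly_sym chF; apply/eq_add_S.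
by rewrite -(size_prod_XsubC _ id) -chF size_char_poly.
Qed.

Lemma alpha_mem (R : rcfType) (m : nat) (F : 'M[R]_m) (i : 'I_m) :
  size (eigenvalues F) = m -> alpha F i \in eigenvalues F.
Proof. by move=> szF; rewrite mem_nth ?szF. Qed.

Lemma in_A_perturbed (R : rcfType) (m n : nat) (F : 'M[R]_m) (G : 'M[R]_n) (b : R)
    (s : {ffun 'I_m -> bool}) (t : 'I_m) :
  size (eigenvalues F) = m -> b \in eigenvalues G ->
  in_A (perturbed F (fun i => shift F G (s i))) t b =
  (\sum_(i < m) (b < alpha F i + shift F G (s i))%R == m - t.+1)%N.
Proof.
move=> szF Gb; have pF := eigenvalues_perturbed F (fun i => shift F G (s i)).
rewrite in_A_count ?(perm_size pF) ?size_map -?enumT ?size_enum_ord //; last first.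
  rewrite (perm_mem pF); apply/mapP => -[i _ /eqP].
  by rewrite eq_sym (negPf (shift_neq _ (alpha_mem i szF) Gb)).
by rewrite (permP pF) count_map -sum1_count big_mkcond big_enum.
Qed.

(** The shifts are independent, so the average factors over the eigenvalues [a] of [F]: the factor
    is ['X] if [a > b], 1 if [a < b], and the mean of both if [a = b]. *)
Lemma sum_perturbed (R : rcfType) (m n : nat) (F : 'M[R]_m) (G : 'M[R]_n) (b : R) :
  size (eigenvalues F) = m -> b \in eigenvalues G ->
  \sum_(s : {ffun 'I_m -> bool})
     (2 ^+ m)^-1 *: 'X^(\sum_(i < m) (b < alpha F i + shift F G (s i))%R) =
  'X^(count (fun a => 0 < a) [seq a - b | a <- eigenvalues F]) *
    (2^-1 *: (1 + 'X)) ^+ count_mem 0 [seq a - b | a <- eigenvalues F]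
  :> {poly rat}.
Proof.
move=> szF Gb; pose E (i : 'I_m) (x : bool) : {poly rat} :=
  2^-1 *: 'X^((b < alpha F i + shift F G x)%R).
transitivity (\sum_(s : {ffun 'I_m -> bool}) \prod_i E i (s i)).
  apply: eq_bigr => s _; rewrite /E scaler_prod prodrXr.
  by rewrite prodr_const card_ord exprVn.
rewrite -bigA_distr_bigA.
pose c (a : R) : {poly rat} :=
  if 0 < a then 'X else if a == 0 then 2^-1 *: (1 + 'X) else 1.
transitivity (\prod_(a <- [seq a - b | a <- eigenvalues F]) c a).
  rewrite [in RHS]eigenvalues_alpha // -map_comp big_map big_enum /=.
  apply: eq_bigr => i _; rewrite big_bool /= /E !(lt_shift _ (alpha_mem i szF) Gb) /c.
  rewrite -scalerDr subr_gt0 subr_eq0.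
  case: ltgtP => _; rewrite ?expr0 ?expr1 1?addrC //.
    by rewrite -mulr2n -scaler_nat scalerA mulVf ?scale1r.
  by rewrite -mulr2n -scaler_nat scalerA mulVf ?scale1r.
elim: [seq _ | _ <- _] => [|a s IHs]; first by rewrite big_nil !expr0 mulr1.
rewrite big_cons IHs /c /=; case: ltgtP => _ /=.
- by rewrite exprS mulrA.
- by rewrite mul1r.
by rewrite exprS mulrCA.
Qed.

Lemma EC_coef (R : rcfType) (m n : nat) (F : 'M[R]_m) (G : 'M[R]_n) (t : 'I_m) :
  size (eigenvalues F) = m ->
  EC F G t 0 = \sum_(b <- eigenvalues G)
    ('X^(count (fun a => 0 < a) [seq a - b | a <- eigenvalues F]) *
      (2^-1 *: (1 + 'X)) ^+ count_mem 0 [seq a - b | a <- eigenvalues F])`_(m - t.+1).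
Proof.
move=> szF; rewrite !mxE summxE mulr_sumr.
under eq_bigr => s _.
  rewrite mxE -sum1_count natr_sum mulr_sumr big_mkcond big_seq.
  over.
rewrite exchange_big big_seq; apply: eq_bigr => b Gb.
rewrite -(sum_perturbed szF Gb) coef_sum; apply: eq_bigr => s _.
rewrite (in_A_perturbed _ _ szF Gb) coefZ coefXn eq_sym.
by case: eqP => _; rewrite ?mulr1 ?mulr0.
Qed.

(** * The algebraic side, and the comparison of both sides *)

Lemma sign_changes_variations (w : seq bool) :
  sign_changes [seq if x then 1 else -1 | x <- w] = variations w.
Proof.
rewrite /sign_changes; set w' := map _ w.
have /all_filterP-> : all (fun x => x != 0) w'.
  by apply/allP => _ /mapP[x _ ->]; case: x.
rewrite {}/w' /variations; elim: w => [//|x [//|y w] IHw].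
rewrite [RHS]/= -[in RHS]IHw.
by case: x y {IHw} => [] [].
Qed.

(** Each signature is a sum over [b] of monomials in the signs of the derivatives at [b]. The
    inverse of [Hmx] turns the vector of these monomials into the weights of the words, and [Vmx]
    collects the words by number of variations. *)
Lemma C_sig_mul (m n : nat) (R : rcfType) (F : 'M[R]_m) (G : 'M[R]_n.+1) (t : 'I_m) :
  G^T = G ->
  (C_sig m *m A_sig F G) t 0 = \sum_(b <- eigenvalues G)
    (variation_poly (fun i : 'I_m => (sgz (char_poly F)^`(i).[b])%:~R))`_(m - t.+1).
Proof.
move=> hG; rewrite -mulmxA mxE.
pose sigma b (i : 'I_m) : rat := (sgz (char_poly F)^`(i).[b])%:~R.
have invA k : (invmx (Hmx m) *m A_sig F G) k 0 =
    \sum_(b <- eigenvalues G) weight (sigma b) (bits k).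
  rewrite mxE invmx_Hmx.
  under eq_bigr => e _.
    rewrite !mxE signature_horner // rmorph_sum mulr_sumr; over.
  rewrite exchange_big; apply: eq_bigr => b _.
  pose H (i : 'I_m) (x : bool) := sgb (bits k i) ^+ x / 2 * sigma b i ^+ x.
  transitivity (\sum_(e : 'I_(2 ^ m)) \prod_i H i (bits e i)).
    apply: eq_bigr => e _; rewrite /f_pow horner_prod.
    rewrite (big_morph (@sgz R) (@sgzM R) (@sgz1 R)) rmorph_prod -big_split /=.
    apply: eq_bigr => i _; rewrite /H digitE; congr (_ * _).
    by case: (bits e i); rewrite ?expr0 ?expr1 // hornerC sgz1.
  rewrite sum_prod_bits; apply: eq_bigr => i _.
  by rewrite /H !expr0 !expr1 mulr1 mulrAC -mulrDl.
under eq_bigr => k _ do rewrite invA mulr_sumr.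
rewrite exchange_big; apply: eq_bigr => b _ /=.
rewrite coef_sum (reindex (@bits m)) /=; last exact/onW_bij/bits_bij.
apply: eq_bigr => k _; rewrite mxE coefZ coefXn mulrC; congr (_ * _%:R).
rewrite eq_sym -sign_changes_variations map_rcons.
congr (_ == sign_changes (rcons _ 1)); rewrite /word -[RHS]map_comp.
by apply: eq_map => i; rewrite sign_atE.
Qed.

Theorem theorem13 (R : realType) (m n : nat)
    (F : 'M[R]_m.+1) (G : 'M[R]_n.+1)
    (hF : F^T = F) (hG : G^T = G) :
  EC F G = C_sig m.+1 *m A_sig F G.
Proof.
have szF := size_eigenvalues_sym hF.
apply/colP => t; rewrite EC_coef // C_sig_mul //; apply: eq_bigr => b _.
(* After translation by [b], the roots above [b] become positive and the root [b] becomes 0, as in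
   [EC_coef]. *)
rewrite (@variation_poly_real_rooted _ _ [seq a - b | a <- eigenvalues F])
  ?size_map // => i.
by rewrite char_poly_sym // sgz_derivn_prod_XsubC.
Qed.
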